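(* Let $N$ be a finite set and let $A\subseteq N$. Then the function $f_A=1_{A\subseteq\bullet}:\mathcal{P}(N)\to\mathbb{R}$, defined by $f_A(S)=1$ if $A\subseteq S$ and $f_A(S)=0$ otherwise, is skeletal.
   Context: $\mathcal{P}(N)$ is the power set of $N$. A function $f:\mathcal{P}(N)\to\mathbb{R}$ is supermodular if $f(E\cup F)+f(E\cap F)\ge f(E)+f(F)$ for all $E,F\subseteq N$; $\mathcal{K}(N)$ is the cone of supermodular functions, and $\mathcal{K}_\ell(N)=\{f\in\mathcal{K}(N)\mid f(S)=0\text{ for }|S|\le 1\}$ is the (pointed polyhedral) cone of standardized supermodular functions. The standardization of $f\in\mathcal{K}(N)$ is $\bar f(E)=f(E)-f(\emptyset)-\sum_{e\in E}(f(\{e\})-f(\emptyset))$. A function $f\in\mathcal{K}(N)$ is called skeletal if its standardization $\bar f$ is an extreme ray of $\mathcal{K}_\ell(N)$. An extreme ray of a polyhedral convex cone is a half line, and saying that $u$ is an extreme ray of a cone means that $\{cu\mid c\ge 0\}$ is an extreme ray of the cone.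
   Formalization: The formal theorem assumes that A has at least two elements; when A is empty or a singleton, f_A is modular, its standardization is 0, and {0} is not a half line, so f_A is not skeletal and the claim as stated fails. *)

(* Defs.v *)
From HB Require Import structures.
From mathcomp Require Import all_boot all_order all_algebra.
From mathcomp Require Import classical_sets reals convex.

Set Implicit Arguments.
Unset Strict Implicit.
Unset Printing Implicit Defensive.

Import Order.TTheory GRing.Theory Num.Theory.

Local Open Scope classical_set_scope.
Local Open Scope ring_scope.

Section Rays.
Variables (R : realType) (V : lmodType R).
Implicit Types (C F L : set V) (u : V).

Definition ray u : set V := [set v | exists2 c : R, 0 <= c & v = c *: u].

Definition half_line L := exists2 u, u != 0 & L = ray u.

(* Face of a convex set: a convex subset F such that every segment of C whose
   relative interior meets F lies in F. *)
Definition is_face C F :=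
  [/\ F `<=` C, convex_set (F : set (convex_lmodType V)) &
      forall (x y : V) (t : R), C x -> C y -> 0 < t < 1 ->
        F (t *: x + (1 - t) *: y) -> F x /\ F y].

Definition is_extreme_ray C L := is_face C L /\ half_line L.

End Rays.

(* R^o rather than R, so that set functions form an R-vector space. *)
Definition setfun (R : realType) (N : finType) := {ffun {set N} -> R^o}.

Section Supermodular.
Variables (R : realType) (N : finType).
Implicit Types (f : setfun R N) (E F S A : {set N}).

Definition supermodular_cone : set (setfun R N) :=
  [set f | forall E F,
     (f E : R) + (f F : R) <= (f (E :|: F) : R) + (f (E :&: F) : R)].

Definition std_supermodular_cone : set (setfun R N) :=
  [set f | supermodular_cone f /\ forall S, (#|S| <= 1)%N -> f S = 0].

Definition standardization f : setfun R N :=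
  [ffun E : {set N} => f E - f finset.set0 - \sum_(e in E) (f [set e]%SET - f finset.set0)].

Definition skeletal f :=
  supermodular_cone f /\
  is_extreme_ray std_supermodular_cone (ray (standardization f)).

Definition superset_indicator A : setfun R N :=
  [ffun S : {set N} => if A \subset S then 1 else 0].

(* When #|A| <= 1 the function is modular, its standardization is 0, and {0}
   is not a half-line. *)
Lemma superset_indicator_not_skeletal A :
  (#|A| <= 1)%N -> ~ skeletal (superset_indicator A).
Proof.
move=> A1 [_ [_ [u u0 eu]]].
have s0 : standardization (superset_indicator A) = 0.
  apply/ffunP => E; rewrite !ffunE; case: (finset.set_0Vmem A) => [->|[a aA]].
    by rewrite !finset.sub0set subrr sub0r big1 ?oppr0// => e _;
       rewrite !ffunE !finset.sub0set subrr.
  have -> : A = [set a]%SET.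
    by apply/esym/eqP; rewrite eqEcard finset.sub1set aA cards1.
  rewrite !finset.sub1set inE subr0; case: ifPn => aE.
    rewrite (bigD1 a)//= big1 ?addr0 ?ffunE ?finset.sub1set ?inE ?eqxx ?subr0 ?subrr//.
    move=> e /andP[_ ea]; rewrite !ffunE !finset.sub1set !inE eq_sym (negbTE ea).
    by rewrite subrr.
  rewrite big1 ?subrr// => e eE; rewrite !ffunE !finset.sub1set !inE.
  by case: eqP => [ae|_]; [rewrite ae eE in aE | rewrite subrr].
have : ray u u by exists 1; rewrite ?ler01// scale1r.
rewrite -eu => -[c _]; rewrite s0 scaler0 => uE.
by rewrite uE eqxx in u0.
Qed.

End Supermodular.

(* Main.v *)
(** Every standardized supermodular function is nonnegative and monotone.
    Since [#|A| > 1], the function [f_A] is its own standardization.  If a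
    proper convex combination of standardized [g] and [h] equals [c *: f_A],
    then on each [S] not containing [A] nonnegativity forces
    [g S = h S = 0], and on each [S] containing [A] monotonicity forces
    [g S = g A] and [h S = h A]; hence [g = g A *: f_A] and [h = h A *: f_A]. *)
Require Import Defs.
From mathcomp Require Import classical_sets interval_inference convex.
From mathcomp Require Import all_boot all_order all_algebra.
From mathcomp Require Import reals.
From mathcomp Require Import lra.

Set Implicit Arguments.
Unset Strict Implicit.
Unset Printing Implicit Defensive.

Import Order.TTheory GRing.Theory Num.Theory.

Local Open Scope ring_scope.

Lemma convex_ray (R : realType) (V : lmodType R) (u : V) :
  convex_set (ray u : set (convex_lmodType V)).
Proof.
move=> x y k /set_mem[a a0 ->] /set_mem[b b0 ->]; apply: mem_set.
exists (k%:num * a + (1 - k%:num) * b); last by rewrite scalerDl -!scalerA.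
by rewrite addr_ge0 // mulr_ge0 // subr_ge0.
Qed.

Section StandardizedSupermodular.
Variables (R : realType) (N : finType).
Implicit Types (f g h : setfun R N) (A E F S : {set N}).

Local Notation K := (@std_supermodular_cone R N).
Local Notation "''f_' A" := (superset_indicator R A) (at level 8, A at level 2).

(** Disjoint sets meet in [set0], where [g] vanishes, so the intersection term drops out. *)
Lemma std_supermodular_superadd g E F :
  K g -> [disjoint E & F] -> (g E : R) + (g F : R) <= g (E :|: F).
Proof.
move=> [gsup g0] /disjoint_setI0 EF0.
by have := gsup E F; rewrite EF0 (g0 set0) ?cards0 // addr0.
Qed.

(** Induction on [#|S|]: splitting off a point [x], where [g [set x] = 0], superadditivity gives
    [g (S :\ x) <= g S]. *)
Lemma std_supermodular_ge0 g S : K g -> (0 : R) <= g S.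
Proof.
move=> Kg; have [n] := ubnP #|S|; elim: n S => // n IHn S ltSn.
have [->|[x xS]] := set_0Vmem S; first by rewrite (proj2 Kg) ?cards0.
have ltSx : (#|S :\ x| < n)%N by rewrite (cardsD1 x) xS in ltSn.
apply: le_trans (IHn _ ltSx) _.
have := @std_supermodular_superadd g [set x] (S :\ x) Kg.
rewrite setD1K // (proj2 Kg [set x]) ?cards1 // add0r; apply.
by rewrite disjoints1 !inE eqxx.
Qed.

Lemma std_supermodular_mono g E F : K g -> E \subset F -> (g E : R) <= g F.
Proof.
move=> Kg sEF.
have EDE : [disjoint E & F :\: E] by rewrite -setI_eq0 setIDA setDIl setDv set0I.
have := std_supermodular_superadd Kg EDE.
(* The union [E :|: (F :\: E)] collapses to [F]; the increment is then at least [g (F :\: E)], which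
   is nonnegative. *)
rewrite setDE setUIr setUCr setIT (setUidPr sEF) -setDE.
by apply: le_trans; rewrite lerDl; apply: std_supermodular_ge0.
Qed.

Lemma ray_superset_indicatorP A g : K g ->
  (forall S, ~~ (A \subset S) -> g S = 0) ->
  (forall S, A \subset S -> g S = g A) -> ray 'f_A g.
Proof.
move=> Kg gN gA; exists (g A); first exact: std_supermodular_ge0.
apply/ffunP => S; rewrite !ffunE /GRing.scale /=.
by case: ifPn => AS; [rewrite mulr1 gA|rewrite mulr0 gN].
Qed.

Lemma superset_indicator_supermodular A : supermodular_cone 'f_A.
Proof.
move=> E F /=; rewrite !ffunE subsetI.
have [AE|_] := boolP (A \subset E).
  rewrite (subset_trans AE (subsetUl E F)) /=.
  by have [_|_] := boolP (A \subset F); lra.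
have [AF|_] := boolP (A \subset F).
  by rewrite (subset_trans AF (subsetUr E F)) /=; lra.
by rewrite /=; case: ifP => _; lra.
Qed.

Section CardGt1.
Variable A : {set N}.
Hypothesis A_gt1 : (1 < #|A|)%N.

(** A set with at most one element is too small to contain [A]. *)
Lemma superset_indicator_small S : (#|S| <= 1)%N -> 'f_A S = 0.
Proof.
move=> S1; rewrite ffunE ifN //.
by apply: contraL A_gt1 => /subset_leq_card AS; rewrite -leqNgt (leq_trans AS).
Qed.

Lemma standardization_superset_indicator : standardization 'f_A = 'f_A.
Proof.
apply/ffunP => E.
rewrite ffunE (superset_indicator_small (S := set0)) ?cards0 // subr0.
rewrite big1 ?subr0 // => e _.
by rewrite superset_indicator_small ?cards1 ?subrr.
Qed.

Lemma ray_superset_indicator_face : is_face K (ray 'f_A).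
Proof.
split; [|exact: convex_ray|].
  move=> g [c c0 ->]; split=> [E F|S S1]; last first.
    by rewrite ffunE superset_indicator_small ?scaler0.
  have cE S : (c *: 'f_A) S = c * ('f_A S : R) by rewrite ffunE.
  rewrite !cE -!mulrDr; apply: ler_wpM2l => //.
  exact: superset_indicator_supermodular.
move=> g h t Kg Kh /andP[t0 t1] [c _ eq_c].
have comb S : t * (g S : R) + (1 - t) * (h S : R) =
    c * (if A \subset S then 1 else 0).
  by have /ffunP /(_ S) := eq_c; rewrite !ffunE.
have t1' : 0 < 1 - t by rewrite subr_gt0.
have zero S : ~~ (A \subset S) -> g S = 0 /\ h S = 0.
  (* Two nonnegative values with positive weights [t] and [1 - t] sum to 0, so both vanish. *)
  move=> /negbTE AS; have := comb S; rewrite AS mulr0.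
  have := std_supermodular_ge0 S Kg; have := std_supermodular_ge0 S Kh.
  by move=> *; split; nra.
have const S : A \subset S -> g S = g A /\ h S = h A.
  (* The combination equals [c] at both [S] and [A], so the weighted sum of [g S - g A] and
     [h S - h A] is 0; by monotonicity both differences are nonnegative, hence zero. *)
  move=> AS; have := comb S; have := comb A; rewrite AS subxx.
  have := std_supermodular_mono Kg AS; have := std_supermodular_mono Kh AS.
  by move=> *; split; nra.
by split; apply: ray_superset_indicatorP => // S /[dup] AS;
  [case/zero|case/const|case/zero|case/const].
Qed.

Lemma superset_indicator_neq0 : 'f_A != 0.
Proof.
apply/eqP => /ffunP /(_ A); rewrite !ffunE subxx => /eqP.
by rewrite oner_eq0.
Qed.

End CardGt1.
End StandardizedSupermodular.

Theorem proposition4p1 (R : realType) (N : finType) (A : {set N})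
    (hA : (1 < #|A|)%N) :
  skeletal (superset_indicator R A).
Proof.
split; first exact: superset_indicator_supermodular.
rewrite standardization_superset_indicator //; split.
  exact: ray_superset_indicator_face.
by exists (superset_indicator R A); first exact: superset_indicator_neq0.
Qed.
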